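(* Let $p,q\in(1,\infty)$ and $p'=\frac p{p-1}$. Then the Laplace transform $L:L^{p,q}(0,\infty)\to L^{p',q}(0,\infty)$ is not strictly singular.
   Context: Laplace transform: $Lf(t)=\int_0^\infty f(s)e^{-ts}\,ds$, $t\in(0,\infty)$; it is bounded $L^{p,q}(0,\infty)\to L^{p',q}(0,\infty)$. Lorentz space $L^{p,q}(0,\infty)$: measurable $f$ with $\|f\|_{p,q}=\big(\int_0^\infty(t^{1/p}f^*(t))^q\frac{dt}t\big)^{1/q}<\infty$, $f^*$ the nonincreasing rearrangement. A bounded linear operator $T:X\to Y$ is strictly singular if there is no infinite-dimensional subspace $Z\subseteq X$ such that $T|_Z$ is an isomorphism onto $T(Z)$. *)

(* Defs.v *)
From mathcomp Require Import all_boot all_order all_algebra.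
From mathcomp Require Import all_classical all_reals all_analysis.
Set Implicit Arguments. Unset Strict Implicit. Unset Printing Implicit Defensive.
Import Order.TTheory GRing.Theory Num.Theory.
Local Open Scope classical_set_scope.
Local Open Scope ring_scope.

Section Lorentz.
Variable R : realType.
Local Notation mu := (@lebesgue_measure R).

Definition halfline : set R := [set t | 0 < t].

Definition distrib (f : R -> R) (s : R) : \bar R :=
  mu (halfline `&` [set t | s < `|f t|]).

Definition rearr (f : R -> R) (t : R) : \bar R :=
  ereal_inf [set s%:E | s in [set s : R | 0 <= s /\ (distrib f s <= t%:E)%E]].

Definition lorentz_norm (p q : R) (f : R -> R) : \bar R :=
  poweR (\int[mu]_(t in halfline)
           (poweR ((powR t p^-1)%:E * rearr f t)%E q * (t^-1)%:E)%E) q^-1.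

Definition LorentzSpace (p q : R) : set (R -> R) :=
  [set f | measurable_fun halfline f /\ (lorentz_norm p q f < +oo)%E].

Definition laplace (f : R -> R) (t : R) : R :=
  fine (\int[mu]_(s in halfline) (f s * expR (- (t * s)))%:E).

Definition lin_subspace (Z : set (R -> R)) : Prop :=
  [/\ Z (fun _ => 0),
      forall f g, Z f -> Z g -> Z (fun x => f x + g x) &
      forall (a : R) f, Z f -> Z (fun x => a * f x)].

(* infinite-dimensional, as a space of functions on (0,oo) modulo a.e. equality:
   for every n, Z contains n linearly independent elements *)
Definition infinite_dim (Z : set (R -> R)) : Prop :=
  forall n : nat, exists g : 'I_n -> R -> R,
    (forall i, Z (g i)) /\
    forall a : 'I_n -> R, (exists i, a i != 0) ->
      ~ mu.-negligible (halfline `&` [set x | \sum_(i < n) a i * g i x != 0]).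

End Lorentz.

(* Main.v *)
Require Import Defs.
From mathcomp Require Import all_boot all_order all_algebra.
From mathcomp Require Import all_classical all_reals all_analysis.
From mathcomp Require Import measurable_realfun ring lra zify.
Import Order.TTheory GRing.Theory Num.Theory.
Import numFieldNormedType.Exports.
Local Open Scope classical_set_scope.
Local Open Scope ring_scope.
Set Implicit Arguments.
Unset Strict Implicit.
Unset Printing Implicit Defensive.

(* Let Z be the span of the functions lam_k^(-1/p) 1_(lam_k, 2 lam_k), for a
   very lacunary sequence lam_k. On Z the L^{p,q} norm of sum_k a_k h_k is at
   most a constant times the l^q norm of a, since the rearrangement at t only
   sees the blocks with 2 lam_k >= t. The Laplace transform of h_k is comparable
   to lam_k^(1/p') at scale t ~ 1/lam_k, and there the contributions of the
   other blocks are negligible: the earlier ones have a much smaller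
   lam^(1/p'), the later ones are killed by the exponential. Hence |Lf| is at
   least lam_j^(1/p') |a_j| up to a small error on an interval of length
   ~ 1/lam_j, which bounds its L^{p',q} norm below by the l^q norm of a. *)

(** * Preliminaries on integrals and disjoint indicators *)

(** The integral of a nonnegative function is a supremum over the simple functions below it, which
    is monotone in the function. This allows comparisons with integrands built from [rearr] without
    studying their measurability. *)
Lemma ge0_le_integral_nonmeas d (T : measurableType d) (R : realType)
    (mu : {measure set T -> \bar R}) (D : set T) (f g : T -> \bar R) :
  (forall x, D x -> (0 <= f x)%E) -> (forall x, D x -> (f x <= g x)%E) ->
  (\int[mu]_(x in D) f x <= \int[mu]_(x in D) g x)%E.
Proof.
move=> f0 fg.
have g0 x : D x -> (0 <= g x)%E by move=> Dx; exact: le_trans (f0 _ Dx) (fg _ Dx).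
rewrite !ge0_integralE//; apply: ereal_sup_le => _ [h /= hf <-].
exists h => // x; apply: le_trans (hf x) _.
by rewrite /patch; case: ifPn => //; rewrite inE => /fg.
Qed.

(* No measurability: Lebesgue measure is defined on all sets, as an outer
   measure. *)
Lemma le_lebesgue_measure (R : realType) (A B : set R) :
  A `<=` B -> (lebesgue_measure A <= lebesgue_measure B)%E.
Proof.
move=> AB.
rewrite /lebesgue_measure /lebesgue_stieltjes_measure /measure_extension.
exact: le_mu_ext.
Qed.

(** For [al < 1] the integrand blows up at 0, so the fundamental theorem of calculus is applied on
    intervals away from 0, and monotone convergence gives the limit. *)
Lemma integral_powR_le (R : realType) (al b : R) : 0 < al -> 0 < b ->
  (\int[@lebesgue_measure R]_(t in `]0%R, b]) (t `^ (al - 1))%:E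
    <= (b `^ al / al)%:E)%E.
Proof.
move=> al0 b0.
(* The shift by 2 keeps the left end point strictly below [b] even for [n = 0]. *)
pose F n := `[b / n.+2%:R, b]%classic.
have lb n : 0 < b / n.+2%:R by rewrite divr_gt0.
have bF : \bigcup_n F n = `]0, b]%classic.
  apply/seteqP; split => [x [n _]|x]; rewrite /F/= !in_itv/=.
    by move=> /andP[h ->]; rewrite (lt_le_trans (lb n) h).
  move=> /andP[x0 xb].
  exists (Num.truncn (b / x)) => //; rewrite /F/= in_itv/= xb andbT.
  rewrite ler_pdivrMr// mulrC -ler_pdivrMr//.
  rewrite (le_trans (ltW (truncnS_gt _)))// ler_nat//.
rewrite -bF.
have mF n : measurable_fun (F n) (EFin \o (fun t : R => t `^ (al - 1))).
  apply/measurable_EFinP; apply: measurable_funTS; exact: measurable_powR.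
have C : (\int[@lebesgue_measure R]_(t in F n) (t `^ (al - 1))%:E
   @[n --> \oo] --> \int[@lebesgue_measure R]_(t in \bigcup_n F n) (t `^ (al - 1))%:E)%E.
  apply: ge0_nondecreasing_set_cvg_integral; last 3 first.
  - by move=> n; exact: measurable_itv.
  - exact: mF.
  - by move=> i x _; rewrite lee_fin powR_ge0.
  - move=> m n mn; apply/subsetPset => x; rewrite /F/= !in_itv/= => /andP[h ->].
    by rewrite andbT (le_trans _ h)// ler_pM2l// lef_pV2 ?posrE// ler_nat.
rewrite -(cvg_lim _ C)//; apply: lime_le; first by apply/cvg_ex; eexists; exact: C.
apply: nearW => n.
have ltb : b / n.+2%:R < b by rewrite ltr_pdivrMr// ltr_pMr// ltr1n.
have pos x : x \in `[b / n.+2%:R, b] -> 0 < x.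
  by rewrite in_itv/= => /andP[h _]; exact: lt_le_trans h.
have dF (x : R) : 0 < x -> is_derive x 1 (fun x : R => al^-1 * x `^ al) (x `^ (al - 1)).
  move=> x0.
  have -> : (fun x : R => al^-1 * x `^ al) = al^-1 *: (fun x : R => x `^ al) by apply/funext.
  apply: is_derive_eq; first by apply: is_deriveZ; exact: is_derive1_powR.
  by rewrite /GRing.scale/= mulrA mulVf ?mul1r ?gt_eqF.
have cF (x : R) : 0 < x -> {for x, continuous (fun x : R => al^-1 * x `^ al)}.
  move=> x0; apply/differentiable_continuous/derivable1_diffP.
  exact: (@ex_derive _ _ _ _ _ _ _ (dF _ x0)).
rewrite (@continuous_FTC2 _ _ (fun x => al^-1 * x `^ al))//.
- rewrite -EFinB lee_fin mulrC gerBl mulr_ge0 ?powR_ge0// invr_ge0 ltW//.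
- apply: derivable_within_continuous => x /pos x0.
  by apply: derivable_powR; rewrite in_itv/= andbT.
- split.
  + move=> x xI; apply: (@ex_derive _ _ _ _ _ _ _ (dF _ _)).
    by apply: pos; exact: subset_itv_oo_cc xI.
  + by apply: cvg_at_right_filter; apply: (cF _ (lb n)).
  + by apply: cvg_at_left_filter; apply: (cF _ b0).
- move=> x xI; rewrite derive1E; apply: (@derive_val _ _ _ _ _ _ _ (dF _ _)).
  by apply: pos; exact: subset_itv_oo_cc xI.
Qed.

Lemma sum_disjoint_indic (R : realType) (A : nat -> set R) (w : nat -> R) n x :
  (forall i j y, A i y -> A j y -> i = j) ->
  \sum_(k < n) w k * \1_(A k) x = 0 \/
  exists2 k, (k < n)%N & A k x /\ \sum_(i < n) w i * \1_(A i) x = w k.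
Proof.
move=> dA; have [[k kn Akx]|H] := pselect (exists2 k, (k < n)%N & A k x); last first.
  left; apply: big1 => k _; rewrite indicE memNset ?mulr0// => Akx.
  by apply: H; exists k.
right; exists k => //; split => //.
rewrite (bigD1 (Ordinal kn))//= indicE mem_set// mulr1 big1 ?addr0// => i ik.
rewrite indicE memNset ?mulr0// => Aix.
by move/eqP: ik; apply; apply/val_inj/(dA _ _ x).
Qed.

(** * Upper and lower bounds for Lorentz norms *)

(** The [q]-th power of [lorentz_norm]. Contributions of different blocks add up in it, so the root
    is taken only at the very end. *)
Definition lorentz_int (R : realType) (p q : R) (f : R -> R) : \bar R :=
  (\int[lebesgue_measure]_(t in @halfline R)
     (poweR ((powR t p^-1)%:E * rearr f t) q * (t^-1)%:E))%E.

Section LorentzBounds.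
Variable R : realType.
Local Notation mu := (@lebesgue_measure R).
Local Notation halfline := (@halfline R).
Implicit Types (f g : R -> R) (p q t : R).

Lemma measurable_halfline : measurable halfline.
Proof.
rewrite (_ : halfline = `]0, +oo[%classic); first exact: measurable_itv.
by apply/seteqP; split => x; rewrite /halfline/= in_itv/= andbT.
Qed.

Lemma lebesgue_measure_oo (a b : R) : a <= b -> mu `]a, b[%classic = (b - a)%:E.
Proof.
rewrite le_eqVlt => /orP[/eqP->|ab].
  by rewrite lebesgue_measure_itv/= ltxx subrr.
by rewrite lebesgue_measure_itv/= lte_fin ab EFinB.
Qed.

Lemma lebesgue_measure_oc (a b : R) : a < b -> mu `]a, b]%classic = (b - a)%:E.
Proof. by move=> ab; rewrite lebesgue_measure_itv/= lte_fin ab EFinB. Qed.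

Lemma rearr_ge0 f t : (0 <= rearr f t)%E.
Proof. by apply: le_ereal_inf_tmp => _ [s [s0 _] <-]; rewrite lee_fin. Qed.

Lemma rearr_le f t s : 0 < t -> 0 <= s ->
  (forall x, t < x -> `|f x| <= s) -> (rearr f t <= s%:E)%E.
Proof.
move=> t0 s0 fs; apply: ereal_inf_lbound; exists s => //; split => //.
rewrite /distrib -[in leRHS](subr0 t) -lebesgue_measure_oc//.
apply: le_lebesgue_measure => x [/= x0 sx]; rewrite in_itv/= x0/= leNgt.
by apply/negP => /fs; rewrite leNgt sx.
Qed.

Lemma rearr_ge f t m (A : set R) : A `<=` halfline ->
  (t%:E < mu A)%E -> (forall x, A x -> m <= `|f x|) -> (m%:E <= rearr f t)%E.
Proof.
move=> A0 tA fm; apply: le_ereal_inf_tmp => _ [s [s0 fs] <-].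
rewrite lee_fin leNgt; apply/negP => sm.
have : (mu A <= t%:E)%E.
  apply: le_trans fs; apply: le_lebesgue_measure => x Ax; split; first exact: A0.
  exact: lt_le_trans sm (fm _ Ax).
by rewrite leNgt tA.
Qed.

Lemma lorentz_int_ge0 p q f : (0 <= lorentz_int p q f)%E.
Proof.
apply: integral_ge0 => t t0; rewrite mule_ge0 ?poweR_ge0// lee_fin invr_ge0.
exact: ltW.
Qed.

(** Beyond [t] the function is bounded by those [b k] with [t <= c k], hence so is its rearrangement
    at [t]. Replacing their maximum by their l^q norm makes the [q]-th power additive, and each term
    is then an integral of t^(q/p-1) over ]0, c_k]. *)
Lemma lorentz_int_le p q f n (b c : nat -> R) : 0 < p -> 0 < q ->
  (forall k, 0 <= b k) -> (forall k, 0 < c k) ->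
  (forall x, 0 < x -> f x = 0 \/ exists2 k, (k < n)%N & x < c k /\ `|f x| <= b k) ->
  (lorentz_int p q f <=
     (\sum_(k < n) b k `^ q * (c k `^ (q / p) / (q / p)))%:E)%E.
Proof.
move=> p0 q0 b0 c0 fbc.
pose B k := (EFin \o (fun t : R => t `^ (q / p - 1))) \_ (`]0, c k]%classic : set R).
have intB k : (\int[mu]_(t in halfline) B k t <= (c k `^ (q / p) / (q / p))%:E)%E.
  rewrite /B -integral_mkcondr setIidr; last first.
    by move=> x/=; rewrite in_itv/= => /andP[].
  by apply: integral_powR_le => //; rewrite divr_gt0.
have B0 k t : (0 <= B k t)%E.
  by rewrite /B /patch; case: ifP => // _; rewrite lee_fin powR_ge0.
have mB k : measurable_fun (halfline : set R) (B k).
  have mc : measurable (`]0, c k]%classic : set R) by exact: measurable_itv.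
  apply: measurable_funTS; apply: (measurable_restrictT _ mc).1.
  by apply: measurable_funTS; apply/measurable_EFinP; exact: measurable_powR.
apply: (@le_trans _ _ (\int[mu]_(t in halfline)
    \sum_(k < n) ((b k `^ q)%:E * B k t))%E); last first.
  rewrite ge0_integral_sum//; last 3 first.
  - exact: measurable_halfline.
  - by move=> k; apply: measurable_funeM; exact: mB.
  - by move=> k t _; rewrite mule_ge0// lee_fin powR_ge0.
  rewrite -sumEFin; apply: lee_sum => k _.
  rewrite ge0_integralZl_EFin//; last 3 first.
  - exact: measurable_halfline.
  - exact: mB.
  - exact: powR_ge0.
  by rewrite EFinM lee_wpmul2l ?lee_fin ?powR_ge0.
apply: ge0_le_integral_nonmeas => t t0.
  by rewrite mule_ge0 ?poweR_ge0// lee_fin invr_ge0 ltW.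
(* S^(1/q) dominates each [b k] whose block reaches beyond [t]. *)
pose S := \sum_(k < n) (if t <= c k then b k `^ q else 0).
have S0 : 0 <= S by apply: sumr_ge0 => k _; case: ifP => // _; exact: powR_ge0.
have fS : (rearr f t <= (S `^ q^-1)%:E)%E.
  apply: rearr_le => //; first exact: powR_ge0.
  move=> x tx; have [->|[k kn [xc fb]]] := fbc x (lt_trans t0 tx).
    by rewrite normr0 powR_ge0.
  apply: le_trans fb _; rewrite -[leLHS](powRr1 (b0 k)) -(divff (lt0r_neq0 q0)) powRrM.
  apply: ge0_ler_powR; rewrite ?nnegrE ?powR_ge0 ?invr_ge0 ?(ltW q0)//.
  rewrite /S (bigD1 (Ordinal kn))//= (ltW (lt_trans tx xc)) lerDl.
  by apply: sumr_ge0 => i _; case: ifP => // _; exact: powR_ge0.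
apply: (@le_trans _ _ (t `^ (q / p - 1) * S)%:E).
  have -> : t `^ (q / p - 1) * S = ((t `^ p^-1 * S `^ q^-1) `^ q * t^-1).
    rewrite powRM ?powR_ge0// -!powRrM mulVf ?gt_eqF// powRr1//.
    rewrite powRB ?powRr1 ?ltW//; last by rewrite (gt_eqF t0) implybT.
    by rewrite [p^-1 * q]mulrC mulrAC.
  rewrite EFinM lee_wpmul2r ?lee_fin ?invr_ge0 ?(ltW t0)//.
  rewrite -[in leRHS]poweR_EFin; apply: gt0_ler_poweR; first exact: ltW.
  - by rewrite in_itv/= leey andbT mule_ge0 ?rearr_ge0// lee_fin powR_ge0.
  - by rewrite in_itv/= leey andbT lee_fin mulr_ge0 ?powR_ge0.
  by rewrite EFinM lee_wpmul2l// lee_fin powR_ge0.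
rewrite mulr_sumr -sumEFin; apply: lee_sum => k _.
rewrite /B /patch; case: ifPn => tk.
  by rewrite mem_set/= ?in_itv/= ?tk ?andbT// mulrC EFinM.
by rewrite memNset ?mulr0 ?mule0//= in_itv/= (negbTE tk) andbF.
Qed.

(** The interval ]2c_k, 4c_k[ has length 2c_k, so the rearrangement of [g] is at least [m k] for
    every t in ]c_k, 2c_k[. There t^(1/p) >= c_k^(1/p) and 1/t >= 1/(2c_k); integrating over length
    c_k leaves the factor 1/2. These intervals of t are disjoint, so the contributions add. *)
Lemma lorentz_int_ge p q g n (m c : nat -> R) : 0 < p -> 0 < q ->
  (forall k, 0 <= m k) -> (forall k, 0 < c k) ->
  (forall i j y, c i < y < 2 * c i -> c j < y < 2 * c j -> i = j) ->
  (forall k, (k < n)%N -> forall x, 2 * c k < x < 4 * c k -> m k <= `|g x|) ->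
  ((\sum_(k < n) (c k `^ p^-1 * m k) `^ q / 2)%:E <= lorentz_int p q g)%E.
Proof.
move=> p0 q0 m0 c0 dc gm.
pose w k := (c k `^ p^-1 * m k) `^ q / (2 * c k).
have w0 k : 0 <= w k by rewrite divr_ge0 ?powR_ge0// mulr_ge0// ltW.
pose J k := `]c k, 2 * c k[%classic.
have mJ k : measurable (J k : set R) by exact: measurable_itv.
have mI k : measurable_fun halfline (fun t : R => (\1_(J k) t)%:E : \bar R).
  by apply/measurable_EFinP; apply: measurable_indic; exact: mJ.
apply: (@le_trans _ _ (\int[mu]_(t in halfline)
    (\sum_(k < n) (w k)%:E * (\1_(J k) t)%:E))%E).
  rewrite ge0_integral_sum//; last 3 first.
  - exact: measurable_halfline.
  - move=> k; apply: measurable_funeM; exact: mI.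
  - by move=> k t _; rewrite mule_ge0// lee_fin.
  rewrite -sumEFin; apply: lee_sum => k _.
  rewrite ge0_integralZl_EFin//; last 2 first.
  - exact: measurable_halfline.
  - exact: mI.
  rewrite integral_indic; last 2 first.
  - exact: measurable_halfline.
  - exact: mJ.
  rewrite setIidl; last first.
    by move=> x; rewrite /J/= in_itv/= => /andP[h _]; exact: lt_trans h.
  have ck := c0 k.
  rewrite [X in (_ * X)%E](@lebesgue_measure_oo (c k) (2 * c k));
    last by rewrite ler_pMl ?ler1n.
  rewrite -EFinM lee_fin /w; have -> : 2 * c k - c k = c k by ring.
  by rewrite [leRHS](_ : _ = (c k `^ p^-1 * m k) `^ q / 2)//; field; rewrite gt_eqF.
apply: ge0_le_integral_nonmeas => t t0.
  by apply: sume_ge0 => k _; rewrite mule_ge0// lee_fin.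
under eq_bigr do rewrite -EFinM.
rewrite sumEFin.
have dJ i j y : J i y -> J j y -> i = j.
  by rewrite /J/= !in_itv/=; exact: dc.
have [->|[k kn [Jk ->]]] := @sum_disjoint_indic R J w n t dJ.
  by rewrite mule_ge0 ?poweR_ge0// lee_fin invr_ge0 ltW.
move: Jk; rewrite /J/= in_itv/= => /andP[ct tc].
rewrite /w EFinM; apply: lee_pmul; rewrite ?lee_fin ?powR_ge0 ?invr_ge0 ?mulr_ge0//.
- exact: ltW.
- rewrite -[leLHS]poweR_EFin; apply: gt0_ler_poweR; first exact: ltW.
  + by rewrite in_itv/= leey andbT lee_fin mulr_ge0 ?powR_ge0.
  + by rewrite in_itv/= leey andbT mule_ge0 ?rearr_ge0// lee_fin powR_ge0.
  rewrite EFinM; apply: lee_pmul; rewrite ?lee_fin ?powR_ge0//.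
    by apply: ge0_ler_powR; rewrite ?nnegrE ?invr_ge0 ?ltW.
  apply: (@rearr_ge _ _ _ `]2 * c k, 4 * c k[%classic).
  + move=> x; rewrite /= in_itv/= => /andP[h _].
    by apply: lt_trans h; rewrite mulr_gt0.
  + rewrite lebesgue_measure_oo ?ler_pM2r ?ler_nat// lte_fin.
    by rewrite (_ : 4 * c k - 2 * c k = 2 * c k)//; ring.
  + by move=> x; rewrite /= in_itv/=; exact: gm.
- by rewrite lef_pV2 ?posrE ?mulr_gt0// ltW.
Qed.

End LorentzBounds.

(** * Laplace transforms of indicators of dyadic blocks *)

Section LaplaceIndicators.
Variable R : realType.
Local Notation mu := (@lebesgue_measure R).
Local Notation halfline := (@halfline R).
Implicit Types (l t : R).

Let A l := `]l, 2 * l[%classic : set R.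

Let mA l : measurable (A l). Proof. exact: measurable_itv. Qed.

Let mI l : measurable_fun halfline (fun s : R => (\1_(A l) s)%:E : \bar R).
Proof. by apply/measurable_EFinP; apply: measurable_indic; exact: mA. Qed.

Let integral_cst_indic l (v : R) : 0 < l -> 0 <= v ->
  (\int[mu]_(s in halfline) (v%:E * (\1_(A l) s)%:E))%E = (l * v)%:E.
Proof.
move=> l0 v0; rewrite ge0_integralZl_EFin//; last 2 first.
- exact: measurable_halfline.
- exact: mI.
rewrite integral_indic; last 2 first.
- exact: measurable_halfline.
- exact: mA.
rewrite setIidl; last first.
  by move=> x; rewrite /A/= in_itv/= => /andP[h _]; exact: lt_trans h.
rewrite [X in (_ * X)%E](@lebesgue_measure_oo R l (2 * l)); last first.
  by rewrite ler_pMl ?ler1n.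
by rewrite -EFinM; congr (_%:E); ring.
Qed.

(** The block has length [l], and the decreasing exponential is at most its value at the left end
    point; the right end point gives the lower bound that follows. *)
Let integral_indic_exp_le l t : 0 < l -> 0 < t ->
  (\int[mu]_(s in halfline) (\1_(A l) s * expR (- (t * s)))%:E
    <= (l * expR (- (t * l)))%:E)%E.
Proof.
move=> l0 t0; rewrite -integral_cst_indic ?expR_ge0//.
apply: ge0_le_integral_nonmeas => s _; first by rewrite lee_fin mulr_ge0 ?expR_ge0.
rewrite -EFinM lee_fin indicE; have [|_] := boolP (s \in A l); last by rewrite mul0r mulr0.
rewrite inE /A/= in_itv/= => /andP[ls _].
by rewrite mul1r mulr1 ler_expR lerN2 ler_pM2l// ltW.
Qed.

Let integral_indic_exp_ge l t : 0 < l -> 0 < t ->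
  ((l * expR (- (t * (2 * l))))%:E <=
   \int[mu]_(s in halfline) (\1_(A l) s * expR (- (t * s)))%:E)%E.
Proof.
move=> l0 t0; rewrite -integral_cst_indic ?expR_ge0//.
apply: ge0_le_integral_nonmeas => s _.
  by rewrite -EFinM lee_fin mulr_ge0 ?expR_ge0.
rewrite -EFinM lee_fin indicE; have [|_] := boolP (s \in A l); last by rewrite mul0r mulr0.
rewrite inE /A/= in_itv/= => /andP[_ ls].
by rewrite mul1r mulr1 ler_expR lerN2 ler_pM2l// ltW.
Qed.

(** [laplace] applies [fine], which sends infinite values to 0; integrability ensures that the
    bounds on the integral pass to [laplace] and that it is linear on block sums. *)
Let integrable_indic_exp l t : 0 < l -> 0 < t ->
  mu.-integrable halfline (fun s => (\1_(A l) s * expR (- (t * s)))%:E).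
Proof.
move=> l0 t0; apply/integrableP; split.
  apply/measurable_EFinP; apply: measurable_funM.
    by apply: measurable_indic; exact: mA.
  apply: measurableT_comp => //; apply: measurable_funTS.
  apply: measurableT_comp => //; exact: mulrl_measurable.
rewrite (le_lt_trans _ (ltry (l * expR (- (t * l)))))//.
rewrite (le_trans _ (integral_indic_exp_le l0 t0))//.
apply: ge0_le_integral_nonmeas => s _ //.
by rewrite gee0_abs// lee_fin mulr_ge0 ?expR_ge0.
Qed.

Lemma laplace_indic_le l t : 0 < l -> 0 < t ->
  laplace (\1_(`]l, 2 * l[%classic)) t <= l * expR (- (t * l)).
Proof.
move=> l0 t0; rewrite -lee_fin /laplace fineK; first exact: integral_indic_exp_le.
by apply: integrable_fin_num; [exact: measurable_halfline|exact: integrable_indic_exp].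
Qed.

Lemma laplace_indic_ge l t : 0 < l -> 0 < t ->
  l * expR (- (t * (2 * l))) <= laplace (\1_(`]l, 2 * l[%classic)) t.
Proof.
move=> l0 t0; rewrite -lee_fin /laplace fineK; first exact: integral_indic_exp_ge.
by apply: integrable_fin_num; [exact: measurable_halfline|exact: integrable_indic_exp].
Qed.

Lemma laplace_sum_indic (l w : nat -> R) n t : (forall k, 0 < l k) -> 0 < t ->
  laplace (fun x => \sum_(k < n) w k * \1_(`]l k, 2 * l k[%classic) x) t =
  \sum_(k < n) w k * laplace (\1_(`]l k, 2 * l k[%classic)) t.
Proof.
move=> l0 t0; rewrite /laplace.
have iE k := integrable_indic_exp (l0 k) t0.
under eq_integral.
  move=> s _; rewrite mulr_suml.
  under eq_bigr do rewrite -mulrA.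
  rewrite -sumEFin.
  under eq_bigr do rewrite EFinM.
  over.
rewrite integral_sum; last 2 first.
- exact: measurable_halfline.
- by move=> k; apply: integrableZl; [exact: measurable_halfline|exact: iE].
have fE k : (\int[mu]_(s in halfline)
    (\1_(`]l k, 2 * l k[%classic) s * expR (- (t * s)))%:E)%E \is a fin_num.
  by apply: integrable_fin_num; [exact: measurable_halfline|exact: iE].
under eq_bigr => k _.
  rewrite integralZl; [|exact: measurable_halfline|exact: iE].
  rewrite -(fineK (fE k)) -EFinM.
  over.
by rewrite sumEFin.
Qed.

End LaplaceIndicators.

(** * Lacunary sequences and dominance of the diagonal term *)

Section LacunarySequence.
Variable R : realType.
Implicit Types (L b t x : R).

(* The square makes the ratio of the terms j < k at least L^(j+1 + k+1), so that
   the off-diagonal terms decay geometrically in both indices at once. *)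
Definition lacunary L k : R := L ^+ (k.+1 ^ 2).

Lemma lacunary_gt0 L k : 0 < L -> 0 < lacunary L k.
Proof. by move=> L0; rewrite exprn_gt0. Qed.

(** The exponents differ by (k+1)^2 - (j+1)^2 = (k-j)(j+k+2), which is at least j+k+2. *)
Lemma lacunary_ratio L j k : 1 <= L -> (j < k)%N ->
  lacunary L j * L ^+ (j.+1 + k.+1) <= lacunary L k.
Proof.
move=> L1 jk; rewrite -exprD; apply: ler_weXn2l => //.
by rewrite !expnS !expn0; nia.
Qed.

Lemma lacunary_double L j k : 2 <= L -> (j < k)%N ->
  2 * lacunary L j <= lacunary L k.
Proof.
move=> L2 jk; have L1 : 1 <= L by apply: le_trans L2; rewrite ler1n.
apply: le_trans (lacunary_ratio L1 jk).
rewrite mulrC ler_pM2l ?lacunary_gt0 ?(lt_le_trans ltr01)//.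
by rewrite (le_trans L2)// exprS ler_peMr ?(le_trans ler01)// exprn_ege1.
Qed.

Lemma powRX (x b : R) n : 0 <= x -> (x ^+ n) `^ b = (x `^ b) ^+ n.
Proof.
by move=> x0; rewrite -powR_mulrn// powRAC powR_mulrn// powR_ge0.
Qed.

(** Both directions occur: the blocks start at an increasing sequence, while the scales on the
    transform side, of order 1/lam_k, decrease. *)
Lemma dyadic_disjoint (u : nat -> R) i j y :
  (forall i j, (i < j)%N -> 2 * u i <= u j) \/
  (forall i j, (i < j)%N -> 2 * u j <= u i) ->
  u i < y < 2 * u i -> u j < y < 2 * u j -> i = j.
Proof.
move=> uu /andP[a1 a2] /andP[b1 b2].
by have [ij|ij|//] := ltngtP i j; exfalso; case: uu => /(_ _ _ ij) {ij}; lra.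
Qed.

(** This comes from e^y >= 1 + y^2/2 at y = x/2. Quadratic decay is enough to beat the growth x^b
    with b <= 1. *)
Lemma expRN_half_le x : 0 < x -> expR (- (x / 2)) <= 8 / x ^+ 2.
Proof.
move=> x0; have x2 : 0 < x / 2 by rewrite divr_gt0.
rewrite expRN -[leRHS]invf_div lef_pV2 ?posrE ?expR_gt0 ?divr_gt0 ?exprn_gt0//.
have := @expR_ge1Dxn _ (x / 2) 1 (ltW x2); rewrite /factorial/= muln1.
by apply: le_trans; rewrite ler_wpDl// le_eqVlt; apply/orP; left; apply/eqP; field.
Qed.

(** For k > j put x = lam_k / lam_j: the growth x^b <= x is beaten by exp(-x/2) <= 8/x^2, which
    leaves 8/x <= 8/x^b. For k < j the exponential is at most 1 and the ratio of the terms gives the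
    decay. *)
Lemma lacunary_offdiag L b t j k : 2 <= L -> 0 < b -> b <= 1 -> j != k ->
  1 / 2 < t * lacunary L j ->
  lacunary L k `^ b * expR (- (t * lacunary L k)) <=
  8 * lacunary L j `^ b / (L `^ b) ^+ (j.+1 + k.+1).
Proof.
move=> L2 b0 b1 jk tj.
have L0 : 0 < L by apply: lt_le_trans L2.
have L1 : 1 <= L by apply: le_trans L2; rewrite ler1n.
have lj := lacunary_gt0 j L0; have lk := lacunary_gt0 k L0.
have t0 : 0 < t by rewrite -(pmulr_lgt0 _ lj) (lt_trans _ tj).
have T0 N : 0 < (L `^ b) ^+ N by rewrite exprn_gt0// powR_gt0.
have L0N N : 0 <= L ^+ N by rewrite exprn_ge0// ltW.
have [lt_jk|lt_kj|/eqP] := ltngtP j k; last by rewrite (negbTE jk).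
- pose x := lacunary L k / lacunary L j.
  have x0 : 0 < x by rewrite divr_gt0.
  have Lx : L ^+ (j.+1 + k.+1) <= x.
    by rewrite ler_pdivlMr// mulrC; exact: lacunary_ratio.
  have x1 : 1 <= x by apply: le_trans Lx; exact: exprn_ege1.
  have kE : lacunary L k = lacunary L j * x.
    by rewrite /x mulrCA divff ?mulr1// gt_eqF.
  have e1 : expR (- (t * lacunary L k)) <= 8 / x ^+ 2.
    apply: le_trans (expRN_half_le x0); rewrite ler_expR lerN2 kE mulrA.
    by rewrite [x / 2]mulrC ler_pM2r// -[2^-1]mul1r ltW.
  have e2 : x `^ b <= x by exact: ler1_powR.
  have e3 : (L `^ b) ^+ (j.+1 + k.+1) <= x `^ b.
    by rewrite -powRX ?(ltW L0)//; apply: ge0_ler_powR; rewrite ?nnegrE ?(ltW b0) ?(ltW x0).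
  rewrite {1}kE powRM ?(ltW lj) ?(ltW x0)//.
  apply: (@le_trans _ _ (lacunary L j `^ b * x * (8 / x ^+ 2))).
    apply: ler_pM; rewrite ?mulr_ge0 ?powR_ge0 ?expR_ge0//.
    by rewrite ler_wpM2l ?powR_ge0.
  have -> : lacunary L j `^ b * x * (8 / x ^+ 2) = 8 * lacunary L j `^ b / x.
    by field; rewrite gt_eqF.
  rewrite ler_wpM2l ?mulr_ge0 ?powR_ge0// lef_pV2 ?posrE//.
  exact: le_trans e3 e2.
- have h : lacunary L k `^ b * (L `^ b) ^+ (j.+1 + k.+1) <= lacunary L j `^ b.
    rewrite -powRX ?(ltW L0)// -powRM ?(ltW lk)//.
    apply: ge0_ler_powR; rewrite ?nnegrE ?(ltW b0) ?mulr_ge0 ?(ltW lk) ?(ltW lj)//.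
    by rewrite addnC; exact: lacunary_ratio.
  rewrite ler_pdivlMr// mulrAC.
  apply: (@le_trans _ _ (lacunary L j `^ b * 1)).
    apply: ler_pM; rewrite ?mulr_ge0 ?powR_ge0 ?expR_ge0 ?(ltW (T0 _))//.
    by rewrite -expR0 ler_expR oppr_le0 mulr_ge0 ?ltW.
  by rewrite mulrC ler_wpM2r ?powR_ge0// ler1n.
Qed.

Lemma sum_half n : \sum_(k < n) (2 : R)^-1 ^+ k.+1 <= 1.
Proof.
suff : \sum_(k < n) (2 : R)^-1 ^+ k.+1 <= 1 - 2^-1 ^+ n.
  by move/le_trans; apply; rewrite gerBl exprn_ge0.
elim: n => [|n IH]; first by rewrite big_ord0 expr0 subrr.
by rewrite big_ord_recr/= exprS; move: IH; lra.
Qed.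

(* With T = dominance_const, sum_k 8 T^-(j+k+2) is at most 16 T^-1 2^-(j+1), that
   is, expR (-2) / 4 * 2^-(j+1). *)
Definition dominance_const : R := 64 * expR 2.

(** As t lam_j < 1, the factor [B j] is at least e^-2 lam_j^b; the other terms are summed by
    [lacunary_offdiag]. The error keeps the factor 2^-(j+1), so that it can later be summed over
    [j]. *)
Lemma lacunary_dominance L b t j n M (a B : nat -> R) :
  2 <= L -> 0 < b -> b <= 1 -> L `^ b = dominance_const ->
  1 / 2 < t * lacunary L j -> t * lacunary L j < 1 -> (j < n)%N ->
  (forall k, `|a k| <= M) ->
  (forall k, lacunary L k `^ b * expR (- (t * (2 * lacunary L k))) <= B k) ->
  (forall k, B k <= lacunary L k `^ b * expR (- (t * lacunary L k))) ->
  lacunary L j `^ b * (expR (- 2) * (`|a j| - M / 4 * 2^-1 ^+ j.+1)) <=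
    `|\sum_(k < n) a k * B k|.
Proof.
move=> L2 b0 b1 LT tj1 tj2 jn aM Bge Ble.
have M0 : 0 <= M by apply: le_trans (aM 0%N).
have P0 : 0 <= lacunary L j `^ b by exact: powR_ge0.
have B0 k : 0 <= B k.
  by apply: le_trans (Bge k); rewrite mulr_ge0 ?powR_ge0 ?expR_ge0.
have T0 : 0 < L `^ b by rewrite powR_gt0// (lt_le_trans _ L2).
have TE : (L `^ b)^-1 = expR (- 2) / 64.
  by rewrite LT /dominance_const invfM expRN mulrC.
have e2 : 0 < expR (- 2) :> R by exact: expR_gt0.
have e21 : expR (- 2) <= 1 :> R by rewrite -expR0 ler_expR oppr_le0.
have TV (i : nat) : (L `^ b)^-1 ^+ i.+1 <= expR (- 2) / 32 * 2^-1 ^+ i.+1.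
  rewrite exprS TE [2^-1 ^+ _]exprS mulrA.
  have -> : expR (- 2) / 32 / 2 = expR (- 2) / 64 :> R by field.
  rewrite ler_wpM2l ?divr_ge0 ?(ltW e2)//; apply: lerXn2r; rewrite ?nnegrE.
  - by rewrite divr_ge0// ltW.
  - by rewrite invr_ge0.
  - by move: e21; lra.
pose r := \sum_(k < n | k != Ordinal jn) a k * B k.
have rle : `|r| <= lacunary L j `^ b * (expR (- 2) * (M / 4 * 2^-1 ^+ j.+1)).
  apply: le_trans (ler_norm_sum _ _ _) _.
  apply: (@le_trans _ _ (\sum_(k < n | k != Ordinal jn)
      (8 * M * lacunary L j `^ b * (L `^ b)^-1 ^+ j.+1) * (L `^ b)^-1 ^+ k.+1)).
    apply: ler_sum => k kj.
    rewrite normrM (ger0_norm (B0 k)).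
    have jk : j != k by rewrite eq_sym; apply: contraNneq kj => kj; apply/eqP/val_inj.
    apply: (@le_trans _ _ (M * (8 * lacunary L j `^ b / (L `^ b) ^+ (j.+1 + k.+1)))).
      apply: ler_pM => //; apply: le_trans (Ble k) _.
      exact: lacunary_offdiag.
    by rewrite exprD invfM -!exprVn le_eqVlt; apply/orP; left; apply/eqP; ring.
  rewrite -mulr_sumr.
  (* From the power in [j] only 2^-(j+1) is kept; the sum over [k] supplies e^-2/32, and 8/32 =
     1/4. *)
  apply: (@le_trans _ _ ((8 * M * lacunary L j `^ b * (1 * 2^-1 ^+ j.+1)) *
      (expR (- 2) / 32 * 1))); last first.
    by rewrite le_eqVlt; apply/orP; left; apply/eqP; field.
  have TV0 i : 0 <= (L `^ b)^-1 ^+ i by rewrite exprn_ge0// invr_ge0 ltW.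
  apply: ler_pM; rewrite ?mulr_ge0 ?sumr_ge0//.
    rewrite ler_wpM2l ?mulr_ge0//; apply: le_trans (TV j) _.
    by rewrite ler_wpM2r ?exprn_ge0 ?invr_ge0//; move: e21; lra.
  apply: (@le_trans _ _ (\sum_(k < n) (L `^ b)^-1 ^+ k.+1)).
    by rewrite [leRHS](bigD1 (Ordinal jn))//= lerDr.
  apply: (@le_trans _ _ (\sum_(k < n) expR (- 2) / 32 * 2^-1 ^+ k.+1)).
    by apply: ler_sum => k _; exact: TV.
  by rewrite -mulr_sumr ler_wpM2l ?divr_ge0 ?(ltW e2)//; exact: sum_half.
have Bj : lacunary L j `^ b * expR (- 2) <= B j.
  apply: le_trans (Bge j); rewrite ler_wpM2l// ler_expR lerN2 mulrCA.
  by move: tj2; lra.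
rewrite (bigD1 (Ordinal jn))//= -/r.
have aB : `|a j| * (lacunary L j `^ b * expR (- 2)) <= `|a j * B j|.
  by rewrite normrM (ger0_norm (B0 j)) ler_wpM2l.
have := lerB_normD (a j * B j) r.
by move: rle aB; lra.
Qed.

End LacunarySequence.

(** * The space spanned by the normalised blocks *)

Section BlockSums.
Variables (R : realType) (p q : R).
Hypotheses (p1 : 1 < p) (q1 : 1 < q).
Local Notation mu := (@lebesgue_measure R).
Local Notation halfline := (@halfline R).

(** [b] is 1/p', and [L] is chosen so that L^b is exactly [dominance_const]. *)
Let b := 1 - p^-1.
Let L := dominance_const R `^ b^-1.
Let lam := lacunary L.
Let block k := `]lam k, 2 * lam k[%classic : set R.

Definition block_sum n (a : nat -> R) x : R :=
  \sum_(k < n) a k * lam k `^ (- p^-1) * \1_(block k) x.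

(** Only finite sums occur, so no convergence question arises; the constants obtained below do not
    depend on [n]. Coefficients form a full sequence so that sums of different lengths can be
    brought to a common length. *)
Definition block_space : set (R -> R) :=
  [set f | exists n a, (forall k, (n <= k)%N -> a k = 0) /\ f = block_sum n a].

Let p0 : 0 < p. Proof. exact: lt_trans p1. Qed.
Let q0 : 0 < q. Proof. exact: lt_trans q1. Qed.
Let b0 : 0 < b. Proof. by rewrite subr_gt0 invf_lt1. Qed.
Let b1 : b <= 1. Proof. by rewrite gerBl invr_ge0 ltW. Qed.

Let dominance_const_ge : 64 <= dominance_const R.
Proof. by rewrite ler_pMr// -expR0 ler_expR. Qed.

Let LT : L `^ b = dominance_const R.
Proof.
rewrite -powRrM mulVf ?gt_eqF// powRr1//.
by apply: le_trans dominance_const_ge.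
Qed.

Let L2 : 2 <= L.
Proof.
apply: (@le_trans _ _ (dominance_const R)).
  by apply: le_trans dominance_const_ge; rewrite ler_nat.
apply: le1r_powR; last by rewrite invf_ge1.
by apply: le_trans dominance_const_ge; rewrite ler1n.
Qed.

Let lam0 k : 0 < lam k.
Proof. by apply: lacunary_gt0; apply: lt_le_trans L2. Qed.

Let lam_double i j : (i < j)%N -> 2 * lam i <= lam j.
Proof. exact: lacunary_double. Qed.

Let block_disjoint i j y : block i y -> block j y -> i = j.
Proof.
by rewrite /block/= !in_itv/=; apply: dyadic_disjoint; left; exact: lam_double.
Qed.

Let mblock k : measurable (block k). Proof. exact: measurable_itv. Qed.

Lemma block_sum_at n a k x : (k < n)%N -> block k x ->
  block_sum n a x = a k * lam k `^ (- p^-1).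
Proof.
move=> kn kx; rewrite /block_sum (bigD1 (Ordinal kn))//= indicE mem_set// mulr1.
rewrite big1 ?addr0// => i ik; rewrite indicE memNset ?mulr0// => ix.
by move/eqP: ik; apply; apply/val_inj/(block_disjoint ix kx).
Qed.

Lemma block_sum_widen n N a : (n <= N)%N -> (forall k, (n <= k)%N -> a k = 0) ->
  block_sum n a = block_sum N a.
Proof.
move=> nN a0; apply/funext => x; rewrite /block_sum.
rewrite (big_ord_widen N (fun k => a k * lam k `^ (- p^-1) * \1_(block k) x) nN).
rewrite big_mkcond/=; apply: eq_bigr => k _; case: ltnP => // /a0 ->.
by rewrite !mul0r.
Qed.

Lemma block_space_subspace : lin_subspace block_space.
Proof.
split.
- exists 0%N, (fun=> 0); split => //.
  by apply/funext => x; rewrite /block_sum big_ord0.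
- move=> _ _ [n [a [a0 ->]]] [m [c [c0 ->]]].
  exists (maxn n m), (fun k => a k + c k); split.
    by move=> k; rewrite geq_max => /andP[/a0 -> /c0 ->]; rewrite addr0.
  apply/funext => x.
  rewrite (block_sum_widen (leq_maxl n m) a0) (block_sum_widen (leq_maxr n m) c0).
  rewrite /block_sum -big_split/=; apply: eq_bigr => k _.
  by rewrite !mulrDl.
- move=> c _ [n [a [a0 ->]]]; exists n, (fun k => c * a k); split.
    by move=> k /a0 ->; rewrite mulr0.
  by apply/funext => x; rewrite /block_sum mulr_sumr; apply: eq_bigr => k _; rewrite !mulrA.
Qed.

(** If a_i is nonzero, the combination is a nonzero constant on the [i]-th block, whose measure
    lam_i is positive. *)
Lemma block_space_infinite_dim : infinite_dim block_space.
Proof.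
move=> n; exists (fun i : 'I_n => block_sum n (fun k => (k == i :> nat)%:R)); split.
  move=> i; exists n, (fun k => (k == i :> nat)%:R); split => // k nk.
  by case: eqP => // ki; move: nk; rewrite ki leqNgt ltn_ord.
move=> a [i ai] [A [mA A0 sub]].
have : (mu (block i) <= 0)%E.
  rewrite -A0; apply: le_lebesgue_measure => x ix; apply: sub.
  split; first by move: ix; rewrite /block/= in_itv/= => /andP[h _]; exact: lt_trans h.
  rewrite /= (bigD1 i)//= big1 => [|j ji].
    by rewrite (block_sum_at _ (ltn_ord i) ix) eqxx mul1r addr0 mulf_neq0// gt_eqF// powR_gt0.
  rewrite (block_sum_at _ (ltn_ord i) ix) (_ : _ == _ = false) ?mul0r ?mulr0//.
  by apply/negbTE; rewrite eq_sym; apply: contraNneq ji => ji; apply/eqP/val_inj.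
rewrite lebesgue_measure_oo; last by rewrite ler_pMl ?ler1n.
by rewrite lee_fin leNgt mulrDl mul1r addrK lam0.
Qed.

(** * Norm estimates on block sums and their Laplace transforms *)

Let Kup : R := 2 `^ (q / p) / (q / p).

(** The normalisation makes the powers of lam_k cancel: the [q]-th power of lam_k^(-1/p) times (2
    lam_k)^(q/p) is 2^(q/p). *)
Lemma block_sum_upper n a :
  (lorentz_int p q (block_sum n a) <= (Kup * \sum_(k < n) `|a k| `^ q)%:E)%E.
Proof.
have w0 k : 0 <= `|a k| * lam k `^ (- p^-1) by rewrite mulr_ge0 ?powR_ge0.
apply: (le_trans (@lorentz_int_le _ p q _ n (fun k => `|a k| * lam k `^ (- p^-1))
  (fun k => 2 * lam k) p0 q0 w0 _ _)).
- by move=> k; rewrite mulr_gt0.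
- move=> x x0; rewrite /block_sum.
  have [->|[k kn [kx ->]]] := @sum_disjoint_indic R block
      (fun k => a k * lam k `^ (- p^-1)) n x block_disjoint; first by left.
  right; exists k => //; split.
    by move: kx; rewrite /block/= in_itv/= => /andP[].
  by rewrite normrM (ger0_norm (powR_ge0 _ _)).
rewrite lee_fin mulr_sumr; apply: ler_sum => k _.
rewrite !powRM ?powR_ge0 ?(ltW (lam0 k))// -powRrM.
rewrite le_eqVlt; apply/orP; left; apply/eqP.
have -> : - p^-1 * q = - (q / p) by rewrite mulNr mulrC.
have : lam k `^ (q / p) != 0 by rewrite gt_eqF// powR_gt0.
rewrite powRN /Kup => h; move: (lam k `^ _) (2 `^ _) (`|a k| `^ _) h => u v w u0.
by field; rewrite u0 !gt_eqF.
Qed.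

Let d : R := expR (- 2).
(** The first factor comes from [lorentz_int_ge] at c_k = 1/(4 lam_k), the second from passing from
    the truncated coefficients [e k] back to [a k]. *)
Let Klow : R := (4^-1 `^ b) `^ q / 2 * ((d / 2) `^ q / 2).

Lemma laplace_block_sum_lower n a : (forall k, (n <= k)%N -> a k = 0) ->
  ((Klow * \sum_(k < n) `|a k| `^ q)%:E <=
   lorentz_int (p / (p - 1)) q (laplace (block_sum n a)))%E.
Proof.
move=> a0.
pose S := \sum_(k < n) `|a k| `^ q.
pose M := S `^ q^-1.
have S0 : 0 <= S by apply: sumr_ge0 => k _; exact: powR_ge0.
have MS : M `^ q = S by rewrite /M -powRrM mulVf ?gt_eqF// powRr1.
have M0 : 0 <= M by exact: powR_ge0.
have aM k : `|a k| <= M.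
  have [nk|kn] := leqP n k; first by rewrite a0// normr0.
  rewrite -[leLHS]powRr1// -(divff (lt0r_neq0 q0)) powRrM.
  apply: ge0_ler_powR; rewrite ?nnegrE ?powR_ge0 ?invr_ge0 ?(ltW q0)//.
  by rewrite /S (bigD1 (Ordinal kn))//= lerDl sumr_ge0// => i _; exact: powR_ge0.
(* The bound from [lacunary_dominance] is negative when a_j is small, whereas [lorentz_int_ge] asks
   for nonnegative heights. *)
pose e j := Num.max 0 (d * (`|a j| - M / 4 * 2^-1 ^+ j.+1)).
pose m j := lam j `^ b * e j.
(* With this scale, 2c_j < t < 4c_j means exactly 1/2 < t lam_j < 1. *)
pose c j := (4 * lam j)^-1.
have e0 j : 0 <= e j by rewrite le_max lexx.
have cl j : c j * lam j = 4^-1 by rewrite /c; field; rewrite gt_eqF.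
have d0 : 0 < d by exact: expR_gt0.
have pb : (p / (p - 1))^-1 = b by rewrite /b; field; rewrite !gt_eqF ?subr_gt0.
have lower : ((\sum_(k < n) (c k `^ b * m k) `^ q / 2)%:E <=
    lorentz_int (p / (p - 1)) q (laplace (block_sum n a)))%E.
  have := @lorentz_int_ge R (p / (p - 1)) q (laplace (block_sum n a)) n m c.
  rewrite pb; apply => //.
  - by rewrite divr_gt0// subr_gt0.
  - by move=> k; rewrite mulr_ge0 ?powR_ge0.
  - by move=> k; rewrite invr_gt0 mulr_gt0.
  - move=> i j y; apply: dyadic_disjoint; right => {}i {}j ij.
    have := lam_double ij; have := lam0 i; have := lam0 j.
    rewrite /c; move: (lam i) (lam j) => u v v0 u0 uv.
    rewrite -ler_pdivlMl// -invfM lef_pV2 ?posrE ?mulr_gt0//.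
    by move: uv; lra.
  move=> j jn t /andP[t1 t2].
  have tj1 : 1 / 2 < t * lam j.
    apply: (@le_lt_trans _ _ (2 * c j * lam j)); last by rewrite ltr_pM2r.
    by rewrite -mulrA cl; lra.
  have tj2 : t * lam j < 1.
    apply: (@lt_le_trans _ _ (4 * c j * lam j)); first by rewrite ltr_pM2r.
    by rewrite -mulrA cl; lra.
  have t0 : 0 < t by apply: lt_trans t1; rewrite mulr_gt0// invr_gt0 mulr_gt0.
  (* The normalisation is absorbed here: lam_k^(-1/p) lam_k = lam_k^b turns the bounds on the
     transform of a block into those of [lacunary_dominance]. *)
  pose B k := lam k `^ (- p^-1) * laplace (\1_(block k)) t.
  have lamb k : lam k `^ (- p^-1) * lam k = lam k `^ b.
    rewrite -{2}[lam k](powRr1 (ltW (lam0 k))) -powRD ?(gt_eqF (lam0 k)) ?implybT//.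
    by rewrite addrC.
  have -> : laplace (block_sum n a) t = \sum_(k < n) a k * B k.
    rewrite [LHS](laplace_sum_indic (fun k => a k * lam k `^ (- p^-1)) n lam0 t0).
    by apply: eq_bigr => k _; rewrite mulrA.
  rewrite /m /e; case: (leP 0 (d * _)) => h; last by rewrite mulr0.
  apply: (@lacunary_dominance _ L b t j n M a B) => // k.
  - rewrite -lamb -mulrA ler_wpM2l ?powR_ge0//; exact: laplace_indic_ge.
  - rewrite -lamb -mulrA ler_wpM2l ?powR_ge0//; exact: laplace_indic_le.
apply: le_trans lower; rewrite lee_fin.
have -> : \sum_(k < n) (c k `^ b * m k) `^ q / 2 =
    (4^-1 `^ b) `^ q / 2 * \sum_(k < n) e k `^ q.
  rewrite mulr_sumr; apply: eq_bigr => k _.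
  rewrite /m mulrA -powRM ?invr_ge0 ?(ltW (lam0 k)) ?mulr_ge0 ?(ltW (lam0 k))//.
  by rewrite cl powRM ?powR_ge0// mulrAC.
rewrite /Klow -mulrA ler_wpM2l ?divr_ge0 ?powR_ge0// -/S.
(* Where |a_j| is not small compared with M 2^-j it is controlled by e_j; the
   remaining terms add up to at most half of S = M^q. *)
have key j : (d / 2) `^ q * `|a j| `^ q <= e j `^ q + (d / 2) `^ q * (S / 2 * 2^-1 ^+ j.+1).
  have h0 : 0 <= (2 : R)^-1 ^+ j.+1 by rewrite exprn_ge0.
  have h1 : (2 : R)^-1 ^+ j.+1 <= 1 by rewrite exprn_ile1// invf_le1// ler1n.
  (* The threshold is twice the error term, so above it at least half of |a_j| survives in [e j]. *)
  have [big|small] := leP (M / 2 * 2^-1 ^+ j.+1) `|a j|.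
    rewrite -powRM ?divr_ge0 ?(ltW d0)// -[leLHS]addr0 lerD//; last first.
      by rewrite mulr_ge0 ?powR_ge0// mulr_ge0// divr_ge0.
    apply: ge0_ler_powR; rewrite ?nnegrE ?(ltW q0) ?mulr_ge0 ?(ltW d0)//.
    rewrite le_max; apply/orP; right; rewrite -mulrA ler_wpM2l ?(ltW d0)//.
    by move: big; lra.
  rewrite -[leLHS]add0r lerD ?powR_ge0// ler_wpM2l ?powR_ge0//.
  apply: (@le_trans _ _ ((M * (2^-1 * 2^-1 ^+ j.+1)) `^ q)).
    apply: ge0_ler_powR; rewrite ?nnegrE ?(ltW q0)//.
      by rewrite !mulr_ge0.
    by rewrite mulrA ltW.
  (* The [q]-th power of 2^-(j+2) is at most 2^-(j+2) since q > 1, and M^q = S. *)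
  rewrite powRM ?mulr_ge0// MS -mulrA ler_wpM2l//.
  apply: ge1r_powR; last exact: ltW.
  rewrite mulr_gt0 ?exprn_gt0//=.
  by move: h0 h1; lra.
have dq : 0 < (d / 2) `^ q by rewrite powR_gt0// divr_gt0.
have : \sum_(k < n) ((d / 2) `^ q * `|a k| `^ q) <=
    \sum_(k < n) (e k `^ q + (d / 2) `^ q * (S / 2 * 2^-1 ^+ k.+1)).
  by apply: ler_sum => k _; exact: key.
rewrite big_split/= -!mulr_sumr -/S.
have := sum_half R n; set H := \sum_(k < n) _ => H1.
have : (d / 2) `^ q * (S / 2 * H) <= (d / 2) `^ q * (S / 2 * 1).
  by rewrite ler_wpM2l ?(ltW dq)// ler_wpM2l// divr_ge0.
lra.
Qed.

Lemma block_space_Lorentz : block_space `<=` LorentzSpace p q.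
Proof.
move=> _ [n [a [_ ->]]]; split.
  apply: measurable_sum => k; apply: measurable_funM.
    exact: measurable_cst.
  by apply: measurable_indic; exact: mblock.
apply: poweR_lty; apply: le_lt_trans (block_sum_upper n a) _.
exact: ltry.
Qed.

Lemma laplace_block_space_bounded_below : exists c : R, 0 < c /\
  forall f, block_space f ->
    (c%:E * lorentz_norm p q f <= lorentz_norm (p / (p - 1)) q (laplace f))%E.
Proof.
have Kup_gt0 : 0 < Kup by rewrite divr_gt0 ?powR_gt0// divr_gt0.
have Klow_gt0 : 0 < Klow.
  by rewrite mulr_gt0 ?divr_gt0 ?powR_gt0// divr_gt0// expR_gt0.
have Kquo : 0 < Klow / Kup by exact: divr_gt0.
(* Both constants compare [q]-th powers of norms with the sum of |a_k|^q, hence the root of their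
   quotient. *)
exists ((Klow / Kup) `^ q^-1); split; first by rewrite powR_gt0.
move=> _ [n [a [a0 ->]]].
rewrite /lorentz_norm -/(lorentz_int p q _) -/(lorentz_int (p / (p - 1)) q _).
rewrite -poweR_EFin -poweRM ?lorentz_int_ge0 ?lee_fin ?(ltW Kquo)//.
apply: gt0_ler_poweR; first by rewrite invr_ge0 ltW.
- by rewrite in_itv/= leey andbT mule_ge0 ?lorentz_int_ge0// lee_fin ltW.
- by rewrite in_itv/= leey andbT lorentz_int_ge0.
apply: le_trans (laplace_block_sum_lower a0).
apply: le_trans (lee_wpmul2l _ (block_sum_upper n a)) _.
  by rewrite lee_fin ltW.
by rewrite -EFinM lee_fin mulrA divfK ?gt_eqF.
Qed.

End BlockSums.

Unset Implicit Arguments.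

(* L : L^{p,q} -> L^{p',q} is not strictly singular: there is an
   infinite-dimensional subspace Z of L^{p,q} on which L is an isomorphism
   onto its image (i.e. bounded below, L being bounded). *)
Theorem theorem2 (R : realType) (p q : R) :
  1 < p -> 1 < q ->
  exists Z : set (R -> R),
    [/\ Z `<=` LorentzSpace p q, lin_subspace Z, infinite_dim Z &
      exists c : R, 0 < c /\
        forall f, Z f ->
          (c%:E * lorentz_norm p q f <= lorentz_norm (p / (p - 1)) q (laplace f))%E].
Proof.
move=> p1 q1; exists (block_space p); split.
- exact: block_space_Lorentz.
- exact: block_space_subspace.
- exact: block_space_infinite_dim.
- exact: laplace_block_space_bounded_below.
Qed.
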